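(* Let $T>0$, let $r\ge 1$, $\alpha>0$ and $p,q\in(0,\infty]$ satisfy $\frac1\alpha<r\le p$. Then there is a constant $c=c(\alpha,r,p,q)$ such that for every metric space $(X,d)$ and every continuous $f:[0,T]\to X$, $$\|V^r f\|_{B^\alpha_{p,q}}\le c\,\|f\|_{B^\alpha_{p,q}},$$ where on the left-hand side $V^rf$ denotes the two-parameter function $(s,t)\mapsto V^rf_{[s,t]}$.
   Context: Let $\Delta_T=\{(s,t)\in[0,T]^2: s\le t\}$. For (measurable) $\chi:\Delta_T\to[0,\infty]$, $\alpha>0$ and $p,q\in(0,\infty]$ put $$\Omega^\chi_p(t)=\sup_{0<h\le t}\Big(\int_0^{T-h}\chi(s,s+h)^p\,ds\Big)^{1/p},\qquad \|\chi\|_{B^\alpha_{p,q}}=\Big(\int_0^T\Big(\frac{\Omega_p^\chi(t)}{t^\alpha}\Big)^q\frac{dt}{t}\Big)^{1/q},$$ with the usual modifications (essential suprema) if $p=\infty$ or $q=\infty$. For a path $f:[0,T]\to X$ in a metric space, $\|f\|_{B^\alpha_{p,q}}:=\|\chi\|_{B^\alpha_{p,q}}$ with $\chi(s,t)=d(f(s),f(t))$. For an interval $I\subset[0,T]$, $$V^rf_I=\sup_{\pi}\Big(\sum_{i=1}^{N-1}d(f(\pi_i),f(\pi_{i+1}))^r\Big)^{1/r},$$ the supremum being over all finite increasing sequences $\pi=\{\pi_1<\dots<\pi_N\}\subset I$. The inequality is understood in $[0,\infty]$. *)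

(* Defs.v *)
From mathcomp Require Import all_boot all_order all_algebra.
From mathcomp Require Import all_classical all_reals all_analysis.
From mathcomp Require Import ess_sup_inf.

Set Implicit Arguments.
Unset Strict Implicit.
Unset Printing Implicit Defensive.

Import Order.TTheory GRing.Theory Num.Theory.
Import numFieldNormedType.Exports.

Local Open Scope classical_set_scope.
Local Open Scope ring_scope.
Local Open Scope ereal_scope.

(* A two-parameter function on {(s, t) in [0, T]^2 : s <= t} is represented by
   a total chi : R -> R -> \bar R; the values outside that triangle are never
   used below. Likewise for paths, given as total functions R -> X. *)

(* The restriction \_ extends by 0 outside `[0, T - h]: for a nonnegative chi
   the L^p norm over R is then the one over [0, T - h], also for p = +oo. *)
Definition omega (R : realType) (T : R) (p : \bar R) (chi : R -> R -> \bar R)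
    (t : R) : \bar R :=
  ereal_sup [set Lnorm (@lebesgue_measure R) p
                   ((fun s : R => chi s (s + h)%R) \_ `[0%R, (T - h)%R])
            | h in `]0%R, t]].

(* Only exponents q in ]0, +oo] are meaningful; -oo gets a dummy value. *)
Definition besov_norm (R : realType) (T alpha : R) (p q : \bar R)
    (chi : R -> R -> \bar R) : \bar R :=
  let w (t : R) := omega T p chi t * ((t `^ alpha)^-1)%:E in
  match q with
  | q'%:E => (\int[@lebesgue_measure R]_(t in `]0%R, T])
                (w t `^ q' * (t^-1)%:E)) `^ (q'^-1)
  | +oo => ess_sup (@lebesgue_measure R) (w \_ `]0%R, T])
  | -oo => 0
  end.

Definition path_besov_norm (R : realType) (X : metricType R) (T alpha : R)
    (p q : \bar R) (f : R -> X) : \bar R :=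
  besov_norm T alpha p q (fun s t => (mdist (f s) (f t))%:E).

Definition r_variation (R : realType) (X : metricType R) (r : R) (f : R -> X)
    (I : set R) : \bar R :=
  ereal_sup [set ((\sum_(i < (size s).-1)
                     mdist (f (s`_i)%R) (f (s`_i.+1)%R) `^ r) `^ r^-1)%R%:E
            | s in [set s : seq R | sorted <%R s
                                     /\ forall x, x \in s -> I x]].

(* Main.v *)
Require Import Defs.
From mathcomp Require Import all_boot all_order all_algebra.
From mathcomp Require Import all_classical all_reals all_analysis.
From mathcomp Require Import ess_sup_inf measurable_realfun.
From mathcomp Require Import zify ring lra.

Import Order.TTheory GRing.Theory Num.Theory.
Import numFieldNormedType.Exports.

Set Implicit Arguments.
Unset Strict Implicit.
Unset Printing Implicit Defensive.

Local Open Scope classical_set_scope.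
Local Open Scope ring_scope.

(** Write delta_j = h / 2^j and let D_jk be the distance between f (s + k delta_j)
and f (s + (k+1) delta_j), for k < 2^j.

Pathwise, the r-variation of f on [s, s + h] is controlled by these dyadic
increments alone. An interval with end points on a fine dyadic grid is a union
of dyadic intervals, at most two of each level, so its increment is at most
twice the sum over the levels of the largest dyadic increment inside it
([dyadic_chain]). If level j receives the weight kappa^(-jr) with kappa < 1,
the sum over the levels becomes geometric, and the r-th power of the increment
is bounded by a weighted sum of the D_jk^r over the dyadic subintervals. That
sum is superadditive in the interval, so it can be added up along a partition
([grid_variation_le]); continuity of f then moves the points of the partition
off the grid ([r_variation_le_dyadic]).

In L^p, translation invariance bounds the norm of each s |-> D_jk by
Omega(delta_j), and r <= p gives, by convexity, the bound
2^(j/r) Omega(delta_j) for the norm of the l^r sum of the 2^j increments of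
level j. Hence, for any mu > 2^(1/r), if Omega(2^-j t) <= K mu^-j for all j,
then the modulus of V^r f at t is at most C K ([omega_variation_le]). The margin
between 2^(1/r) and mu pays for the weights and for summing over j.

Finally, K can be taken, for finite q, to be the l^q norm of the sequence
mu^j Omega(2^-j t). The dilation t |-> 2^-j t multiplies t^-alpha by
2^(j alpha) and leaves dt/t invariant, so the q-th power of the Besov norm of
V^r f is, up to a constant, at most that of f times a geometric series of ratio
(mu / 2^alpha)^q, which converges when mu < 2^alpha
([besov_norm_transfer_fin], and [besov_norm_transfer_infty] for q infinite). A mu
with 2^(1/r) < mu < 2^alpha exists precisely because 1/alpha < r. Bounding sums
by weighted suprema, at the price of a slightly larger mu, works for every
q > 0. *)

(** * Powers, means and geometric series *)

Lemma ler_powR2r (R : realType) (r x y : R) :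
  0 < r -> 0 <= x -> 0 <= y -> (x `^ r <= y `^ r) = (x <= y).
Proof.
move=> r0 x0 y0; apply/idP/idP => [|xy]; last first.
  by rewrite ge0_ler_powR// ltW.
by apply: contraTT; rewrite -!ltNge => yx; exact: gt0_ltr_powR.
Qed.

Lemma powRV (R : realType) (x q : R) : 0 <= x -> x^-1 `^ q = (x `^ q)^-1.
Proof. by move=> x0; rewrite -powR_inv1// -powRrM mulN1r powRN. Qed.

Lemma lee_poweR2r (R : realType) (r : R) (x y : \bar R) :
  0 < r -> (0 <= x)%E -> (0 <= y)%E -> (x `^ r <= y `^ r)%E = (x <= y)%E.
Proof.
move=> r0; case: x => [x| |]// x0; case: y => [y| |]// y0.
- by rewrite !poweR_EFin !lee_fin ler_powR2r// -lee_fin.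
- by rewrite poweRyr ?gt_eqF// !leey.
- by rewrite poweRyr ?gt_eqF// poweR_EFin !leye_eq.
- by rewrite !lexx.
Qed.

Lemma lee_mulV (R : realType) (x : \bar R) (a y : R) : 0 < a ->
  (x * (a^-1)%:E <= y%:E)%E = (x <= (y * a)%:E)%E.
Proof.
move=> a0; case: x => [x| |].
- by rewrite -EFinM !lee_fin ler_pdivrMr.
- by rewrite gt0_mulye ?lte_fin ?invr_gt0// !leye_eq.
- by rewrite gt0_mulNye ?lte_fin ?invr_gt0// !leNye.
Qed.

(** Convexity of the power q, one summand at a time: in the step from n to n + 1
the new summand gets weight 1/(n + 1) and the mean of the others the rest. *)
Lemma power_mean_le (R : realType) (n : nat) (q : R) (x : nat -> R) :
  1 <= q -> (forall k, 0 <= x k) ->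
  (\sum_(k < n) x k) `^ q <= n%:R `^ (q - 1) * \sum_(k < n) x k `^ q.
Proof.
move=> q1 x0; have q0 : 0 < q by exact: lt_le_trans q1.
elim: n => [|n IH]; first by rewrite !big_ord0 mulr0 powR0// gt_eqF.
have [n0|n0] := posnP n.
  by rewrite n0 !big_ord1 powR1 mul1r.
rewrite !big_ord_recr /=; move: IH; set S := \sum_(_ < _) x _.
set P := \sum_(_ < _) _ `^ q => IH.
have nR : 0 < n%:R :> R by rewrite ltr0n.
have nR1 : 0 < n.+1%:R :> R by rewrite ltr0n.
have S0 : 0 <= S by exact: sumr_ge0.
have t0 : 0 <= (n.+1%:R^-1 : R) by rewrite invr_ge0.
have t1 : (n.+1%:R^-1 : R) <= 1 by rewrite invf_le1// ler1n.
have cvx : (n.+1%:R^-1 * (x n * n.+1%:R) +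
            (1 - n.+1%:R^-1) * (S / n%:R * n.+1%:R)) `^ q
    <= n.+1%:R^-1 * (x n * n.+1%:R) `^ q +
       (1 - n.+1%:R^-1) * (S / n%:R * n.+1%:R) `^ q.
  apply: (convex_powR q1 (Itv01 t0 t1)) => /=;
    by rewrite inE /= in_itv /= andbT !mulr_ge0 ?divr_ge0 ?(ltW nR) ?(ltW nR1).
move: cvx.
have -> : n.+1%:R^-1 * (x n * n.+1%:R) + (1 - n.+1%:R^-1) * (S / n%:R * n.+1%:R)
    = S + x n.
  by rewrite -[n.+1%:R]natr1; field; rewrite natr1 !gt_eqF.
move=> /le_trans; apply.
rewrite !powRM ?divr_ge0 ?invr_ge0 ?(ltW nR) ?(ltW nR1)//.
rewrite powRB; last by apply/implyP => _; rewrite gt_eqF.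
rewrite powRr1 ?(ltW nR1)//.
have -> : 1 - n.+1%:R^-1 = n%:R / n.+1%:R :> R.
  by rewrite -[n.+1%:R]natr1; field; rewrite natr1 gt_eqF.
have IH' : n%:R * (S `^ q * n%:R^-1 `^ q) <= P.
  move: IH; rewrite powRB; last by apply/implyP => _; rewrite gt_eqF.
  rewrite powRr1 ?(ltW nR)// => IH.
  rewrite [n%:R^-1 `^ q]powRV ?(ltW nR)//.
  have -> : n%:R * (S `^ q * (n%:R `^ q)^-1) = S `^ q / (n%:R `^ q / n%:R).
    by field; rewrite !gt_eqF ?powR_gt0.
  by rewrite ler_pdivrMr ?divr_gt0 ?powR_gt0// mulrC.
set w := _ `^ q in IH' *.
have wn0 : 0 <= n.+1%:R `^ q / n.+1%:R by rewrite divr_ge0 ?powR_ge0 ?ltW.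
rewrite [leRHS]mulrDr addrC.
apply: lerD; last by rewrite le_eqVlt; apply/orP; left; apply/eqP; ring.
apply: le_trans (ler_wpM2l wn0 IH'); rewrite le_eqVlt; apply/orP.
by left; apply/eqP; ring.
Qed.

Lemma nneseries_geometric_le (R : realType) (a k : R) :
  0 <= a -> 0 < k < 1 ->
  (\sum_(j <oo) (a * k ^+ j)%:E <= (a / (1 - k))%:E)%E.
Proof.
move=> a0 /andP[k0 k1]; apply: lime_le.
  by apply: is_cvg_nneseries => j _ _; rewrite lee_fin mulr_ge0// exprn_ge0// ltW.
apply: nearW => n; rewrite sumEFin lee_fin.
have := @geometric_le_lim _ n a k a0 k0; rewrite ger0_norm ?(ltW k0)//.
by apply.
Qed.

(** * Dyadic chaining on a grid *)

(** Induction on the depth of the grid: strip at most one unit step at each end,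
which costs e 0 twice and leaves even end points, then halve the grid. *)
Lemma dyadic_chain (R : realType) (X : metricType R) (N : nat) (g : nat -> X)
    (e : nat -> R) (a b : nat) :
  (a <= b)%N -> (b <= 2 ^ N)%N -> (forall u, 0 <= e u) ->
  (forall u k, (a <= k * 2 ^ u)%N -> (k.+1 * 2 ^ u <= b)%N ->
     mdist (g (k * 2 ^ u)%N) (g (k.+1 * 2 ^ u)%N) <= e u) ->
  mdist (g a) (g b) <= 2 * \sum_(u < N.+1) e u.
Proof.
elim: N g e a b => [|N IH] g e a b ab bN e0 he.
  rewrite big_ord1; have [->|aNb] := eqVneq a b.
    by rewrite mdistxx mulr_ge0.
  have [-> ->] : a = 0%N /\ b = 1%N by lia.
  apply: (@le_trans _ _ (e 0%N)); last by rewrite ler_peMl// ler1n.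
  by have := he 0%N 0%N; rewrite expn0 !muln1; apply; lia.
have [->|aNb] := eqVneq a b.
  by rewrite mdistxx mulr_ge0// sumr_ge0.
(* 2a' and 2b' are a rounded up and b rounded down to even numbers *)
pose a' := a.+1./2; pose b' := b./2.
have a'b' : (a' <= b')%N by rewrite /a' /b'; lia.
have step k : (a <= k)%N -> (k.+1 <= b)%N -> mdist (g k) (g k.+1) <= e 0%N.
  by move=> ak kb; have := he 0%N k; rewrite expn0 !muln1; apply.
have left_step : mdist (g a) (g a'.*2) <= e 0%N.
  rewrite /a'; have [odda|evena] := boolP (odd a).
    have -> : (a.+1./2).*2 = a.+1 by lia.
    by apply: step; lia.
  have -> : (a.+1./2).*2 = a by lia.
  by rewrite mdistxx.
have right_step : mdist (g b'.*2) (g b) <= e 0%N.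
  rewrite /b'; have [oddb|evenb] := boolP (odd b).
    have bE : b = b./2.*2.+1 by lia.
    by have := step b./2.*2; rewrite -bE; apply; lia.
  have -> : (b./2).*2 = b by lia.
  by rewrite mdistxx.
have mid : mdist (g a'.*2) (g b'.*2) <= 2 * \sum_(u < N.+1) e u.+1.
  apply: (IH (fun k => g k.*2) (fun u => e u.+1)) => //.
  - by move: bN; rewrite expnS /b'; lia.
  - move=> u k ak kb; have := he u.+1 k; rewrite expnS.
    have -> : (k * (2 * 2 ^ u) = (k * 2 ^ u).*2)%N by lia.
    have -> : (k.+1 * (2 * 2 ^ u) = (k.+1 * 2 ^ u).*2)%N by lia.
    by apply; move: ak kb; rewrite /a' /b'; lia.
rewrite big_ord_recl /=.
have := metric_triangle (g a) (g a'.*2) (g b).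
have := metric_triangle (g a'.*2) (g b'.*2) (g b).
under [X in _ -> _ -> _ <= _ * (_ + X)]eq_bigr do rewrite /bump leq0n add1n.
by move: left_step right_step mid; lra.
Qed.

(** The grid of step 2^-N is indexed by integers, so a dyadic interval of level j
has integer length 2^(N - j). Restricting the sum to the dyadic intervals inside
[a, b] is what makes it superadditive. *)
Definition dyadic_energy {R : realType} {X : metricType R} (r kappa : R)
    (N : nat) (g : nat -> X) (a b : nat) : R :=
  \sum_(j < N.+1) (kappa `^ r) ^- j *
    \sum_(k < 2 ^ j | (a <= k * 2 ^ (N - j))%N && (k.+1 * 2 ^ (N - j) <= b)%N)
      mdist (g (k * 2 ^ (N - j))%N) (g (k.+1 * 2 ^ (N - j))%N) `^ r.

Lemma dyadic_energy_ge0 (R : realType) (X : metricType R) (r kappa : R)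
    (N : nat) (g : nat -> X) (a b : nat) :
  0 <= dyadic_energy r kappa N g a b.
Proof.
apply: sumr_ge0 => j _; rewrite mulr_ge0 ?invr_ge0 ?exprn_ge0 ?powR_ge0//.
by apply: sumr_ge0 => k _; exact: powR_ge0.
Qed.

(** A dyadic interval cannot lie both in [a, b] and in [b, c]. *)
Lemma dyadic_energy_superadditive (R : realType) (X : metricType R)
    (r kappa : R) (N : nat) (g : nat -> X) (a b c : nat) :
  (a <= b)%N -> (b <= c)%N ->
  dyadic_energy r kappa N g a b + dyadic_energy r kappa N g b c
    <= dyadic_energy r kappa N g a c.
Proof.
move=> ab bc; rewrite /dyadic_energy -big_split /=; apply: ler_sum => j _.
rewrite -mulrDr ler_wpM2l ?invr_ge0 ?exprn_ge0 ?powR_ge0//.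
rewrite !(big_mkcond (fun k : 'I__ => _ && _)) -big_split /=.
apply: ler_sum => k _; set d := _ `^ r.
have d0 : 0 <= d by exact: powR_ge0.
have : (0 < 2 ^ (N - j))%N by rewrite expn_gt0.
set D := (2 ^ _)%N; rewrite mulSn => D0.
case: ifPn => h1; case: ifPn => h2; case: ifPn => h3;
  rewrite ?addr0 ?add0r//; lia.
Qed.

(** Each dyadic increment of level j inside [a, b] is at most kappa^j times the
r-th root of the energy; chaining sums these bounds over j. *)
Lemma mdist_le_dyadic_energy (R : realType) (X : metricType R) (r kappa : R)
    (N : nat) (g : nat -> X) (a b : nat) :
  0 < r -> 0 < kappa < 1 -> (a <= b)%N -> (b <= 2 ^ N)%N ->
  mdist (g a) (g b) `^ r
    <= (2 / (1 - kappa)) `^ r * dyadic_energy r kappa N g a b.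
Proof.
move=> r0 /andP[k0 k1] ab bN.
set W := dyadic_energy _ _ _ _ _ _.
have W0 : 0 <= W by exact: dyadic_energy_ge0.
pose w := W `^ r^-1.
have wr : w `^ r = W by rewrite /w -powRrM mulVf ?gt_eqF// powRr1.
have w0 : 0 <= w by exact: powR_ge0.
have kr0 : 0 < kappa `^ r by exact: powR_gt0.
rewrite -wr -powRM ?divr_ge0 ?subr_ge0 ?(ltW k1)//.
rewrite ler_powR2r ?mdist_ge0//; last first.
  by rewrite mulr_ge0// divr_ge0// subr_ge0 ltW.
apply: (@le_trans _ _ (2 * \sum_(u < N.+1) kappa ^+ (N - u) * w)).
  apply: (@dyadic_chain _ _ N g (fun u => kappa ^+ (N - u) * w)) => //.
    by move=> u; rewrite mulr_ge0// exprn_ge0// ltW.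
  move=> u k ak kb; have uN : (u <= N)%N.
    rewrite -(leq_exp2l (m := 2))//.
    by apply: leq_trans bN; apply: leq_trans kb; rewrite mulSn leq_addr.
  set d := mdist _ _.
  have d0 : 0 <= d by exact: mdist_ge0.
  rewrite -(ler_powR2r r0)// ?mulr_ge0 ?exprn_ge0 ?(ltW k0)//.
  rewrite powRM ?exprn_ge0 ?(ltW k0)// wr -powR_mulrn ?(ltW k0)// powRAC.
  rewrite powR_mulrn ?powR_ge0//.
  rewrite -ler_pdivrMl ?exprn_gt0//.
  have jN : (N - u < N.+1)%N by lia.
  have NK : (N - (N - u) = u)%N by lia.
  have kN : (k < 2 ^ (N - u))%N.
    rewrite -(leq_pmul2r (m := 2 ^ u)) ?expn_gt0// -expnD subnK//.
    exact: leq_trans bN.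
  rewrite /W /dyadic_energy (bigD1 (Ordinal jN))//= NK.
  rewrite (bigD1 (Ordinal kN))/= ?ak ?kb// -/d.
  rewrite mulrDr -addrA lerDl addr_ge0//.
    rewrite mulr_ge0 ?invr_ge0 ?exprn_ge0 ?powR_ge0//.
    by apply: sumr_ge0 => ? _; exact: powR_ge0.
  apply: sumr_ge0 => j _; rewrite mulr_ge0 ?invr_ge0 ?exprn_ge0 ?powR_ge0//.
  by apply: sumr_ge0 => ? _; exact: powR_ge0.
rewrite -mulr_suml mulrA ler_wpM2r// ler_pM2l//.
rewrite (reindex_inj rev_ord_inj)/=.
under eq_bigr => i _ do rewrite subSS subKn ?leq_ord//.
have := @geometric_le_lim _ N.+1 1 kappa ler01 k0.
rewrite ger0_norm ?(ltW k0)// mul1r => /(_ k1); rewrite seriesEord /=.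
by under eq_bigr do rewrite mul1r.
Qed.

Lemma grid_variation_le_energy (R : realType) (X : metricType R) (r kappa : R)
    (N : nat) (g : nat -> X) (n : nat) (m : nat -> nat) :
  0 < r -> 0 < kappa < 1 -> (forall i, (i < n)%N -> (m i <= m i.+1)%N) ->
  (m n <= 2 ^ N)%N ->
  \sum_(i < n) mdist (g (m i)) (g (m i.+1)) `^ r
    <= (2 / (1 - kappa)) `^ r * dyadic_energy r kappa N g (m 0%N) (m n).
Proof.
move=> r0 k01; elim: n => [|n IH] mm mN.
  by rewrite big_ord0 mulr_ge0 ?powR_ge0 ?dyadic_energy_ge0.
have mnN : (m n <= 2 ^ N)%N by apply: leq_trans mN; exact: mm.
have m0n : (m 0 <= m n)%N.
  have : forall i, (i <= n)%N -> (m 0 <= m i)%N.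
    elim=> // i IHi ilt; apply: (leq_trans (IHi (ltnW ilt))).
    exact/mm/ltnW.
  exact.
rewrite big_ord_recr /=.
apply: (@le_trans _ _ ((2 / (1 - kappa)) `^ r *
  (dyadic_energy r kappa N g (m 0%N) (m n) +
   dyadic_energy r kappa N g (m n) (m n.+1)))).
  rewrite mulrDr lerD//; first by apply: IH => // i ilt; apply: mm; lia.
  by apply: mdist_le_dyadic_energy => //; exact: mm.
by rewrite ler_wpM2l ?powR_ge0// dyadic_energy_superadditive//; exact: mm.
Qed.

(** The bound M kappa^(2j) on level j is stronger by kappa^j than what the weights
of the energy cost, so the energy is a convergent geometric series. *)
Lemma grid_variation_le (R : realType) (X : metricType R) (r kappa M : R)
    (N : nat) (g : nat -> X) (n : nat) (m : nat -> nat) :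
  1 <= r -> 0 < kappa < 1 -> 0 <= M ->
  (forall j, (j <= N)%N ->
    \sum_(k < 2 ^ j) mdist (g (k * 2 ^ (N - j))%N)
                           (g (k.+1 * 2 ^ (N - j))%N) `^ r
      <= (M * kappa ^+ (2 * j)) `^ r) ->
  (forall i, (i < n)%N -> (m i <= m i.+1)%N) -> (m n <= 2 ^ N)%N ->
  \sum_(i < n) mdist (g (m i)) (g (m i.+1)) `^ r
    <= (2 / (1 - kappa) ^+ 2 * M) `^ r.
Proof.
move=> r1 /andP[k0 k1] M0 hM mm mN.
have r0 : 0 < r by exact: lt_le_trans r1.
have k1' : 0 < 1 - kappa by rewrite subr_gt0.
have kr0 : 0 < kappa `^ r by exact: powR_gt0.
apply: (le_trans (@grid_variation_le_energy _ _ r kappa N g n m r0 _ mm mN)).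
  exact/andP.
have -> : 2 / (1 - kappa) ^+ 2 * M = 2 / (1 - kappa) * ((1 - kappa)^-1 * M).
  by field; rewrite gt_eqF.
rewrite [leRHS]powRM ?mulr_ge0 ?invr_ge0 ?(ltW k1')//.
rewrite ler_wpM2l ?powR_ge0//.
apply: (@le_trans _ _ (\sum_(j < N.+1) M `^ r * kappa ^+ j)).
  apply: ler_sum => j _.
  apply: (@le_trans _ _ ((kappa `^ r) ^- j * (M * kappa ^+ (2 * j)) `^ r)).
    rewrite ler_wpM2l ?invr_ge0 ?exprn_ge0 ?(ltW kr0)//.
    apply: le_trans (hM j (leq_ord j)); rewrite big_mkcond /=.
    by apply: ler_sum => k _; case: ifP => // _; exact: powR_ge0.
  rewrite powRM ?exprn_ge0 ?(ltW k0)//.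
  rewrite -(powR_mulrn (2 * j)) ?(ltW k0)// powRAC.
  rewrite powR_mulrn ?(ltW kr0)// mulrCA ler_wpM2l ?powR_ge0//.
  have -> : (kappa `^ r) ^- j * (kappa `^ r) ^+ (2 * j) = (kappa `^ r) ^+ j.
    by rewrite mul2n -addnn exprD mulKf// expf_neq0// gt_eqF.
  rewrite lerXn2r ?nnegrE ?(ltW kr0) ?(ltW k0)//.
  by apply: ge1r_powR => //; rewrite k0 ltW.
rewrite -mulr_sumr powRM ?invr_ge0 ?(ltW k1')// mulrC ler_wpM2r ?powR_ge0//.
apply: (@le_trans _ _ (1 - kappa)^-1).
  have := @geometric_le_lim _ N.+1 1 kappa ler01 k0.
  rewrite ger0_norm ?(ltW k0)// mul1r => /(_ k1); rewrite seriesEord /=.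
  by under eq_bigr do rewrite mul1r.
apply: le1r_powR => //; rewrite invf_ge1//; lra.
Qed.

(** * From the grid to continuous paths *)

Lemma within_continuous_mdist (R : realType) (X : metricType R) (A : set R)
    (f : R -> X) (x e : R) :
  {within A, continuous f} -> A x -> 0 < e ->
  exists2 d, 0 < d &
    forall y, A y -> `|x - y| < d -> mdist (f x) (f y) < e.
Proof.
move=> /subspace_continuousP /[apply] /cvg_ballP /[apply].
rewrite near_withinE => -[d /= d0 hd]; exists d => // y Ay xy.
by have := hd y xy Ay; rewrite ballEmdist.
Qed.

Lemma near_half_pow_lt (R : realType) (h d : R) : 0 < d ->
  \forall N \near \oo, `|h / 2 ^+ N| < d.
Proof.
move=> d0; have h1 : `|2^-1 : R| < 1 by rewrite ger0_norm ?invr_ge0//; lra.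
have /cvgr0Pnorm_lt/(_ _ d0) := @cvg_geometric R h _ h1.
by apply: filterS => N; rewrite /= exprVn.
Qed.

(** Every point of a partition is rounded down to the grid of step h / 2^N, where
the grid bound applies uniformly in N; then N tends to infinity. Rather than
passing to the limit inside the powers, each increment of f is compared with its
rounded version up to a factor l < 1, and l tends to 1. *)
Lemma r_variation_le_dyadic (R : realType) (X : metricType R) (f : R -> X)
    (r kappa M a h : R) :
  1 <= r -> 0 < kappa < 1 -> 0 <= M -> 0 < h ->
  {within `[a, a + h], continuous f} ->
  (forall j, \sum_(k < 2 ^ j) mdist (f (a + k%:R * (h / 2 ^+ j)))
                                    (f (a + k.+1%:R * (h / 2 ^+ j))) `^ r
               <= (M * kappa ^+ (2 * j)) `^ r) ->
  (r_variation r f `[a, (a + h)%R] <= (2 / (1 - kappa) ^+ 2 * M)%:E)%E.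
Proof.
move=> r1 k01 M0 h0 cf hM; set B := _ * M.
have r0 : 0 < r by exact: lt_le_trans r1.
have B0 : 0 <= B by rewrite mulr_ge0// divr_ge0// sqr_ge0.
apply: ge_ereal_sup => _ [s [ss sI] <-]; rewrite lee_fin.
have [s0|] := posnP (size s).
  by rewrite s0 big_ord0 powR0// invr_eq0 gt_eqF.
move=> s_gt0; set n := (size s).-1; set S := \sum_(i < _) _.
have S0 : 0 <= S by apply: sumr_ge0 => i _; exact: powR_ge0.
pose x (i : nat) : R := s`_i.
have xI i : (i < size s)%N -> a <= x i <= a + h.
  by move=> /(mem_nth 0)/sI /=; rewrite in_itv.
pose m N (i : nat) := Num.truncn ((x i - a) / h * 2 ^+ N).
pose y N i := a + (m N i)%:R * (h / 2 ^+ N).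
have p2 N : 0 < 2 ^+ N :> R by rewrite exprn_gt0.
have yx N i : a <= x i -> y N i <= x i < y N i + h / 2 ^+ N.
  move=> ax; pose q := (x i - a) / h * 2 ^+ N.
  have q0 : 0 <= q.
    by rewrite mulr_ge0 ?(ltW (p2 N))// divr_ge0 ?(ltW h0)// subr_ge0.
  have /andP[] := truncn_itv q0; rewrite -/(m N i) /y => h1 h2.
  have xE : x i = a + q * (h / 2 ^+ N).
    by rewrite /q; field; rewrite !gt_eqF.
  have hN : 0 < h / 2 ^+ N by rewrite divr_gt0.
  apply/andP; split; first by rewrite xE lerD2l ler_pM2r.
  rewrite xE -addrA ltrD2l.
  have -> : (m N i)%:R * (h / 2 ^+ N) + h / 2 ^+ N = (m N i).+1%:R * (h / 2 ^+ N).
    by rewrite -[(m N i).+1%:R]natr1 mulrDl mul1r.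
  by rewrite ltr_pM2r.
have grid N : \sum_(i < n) mdist (f (y N i)) (f (y N i.+1)) `^ r <= B `^ r.
  pose g k := f (a + k%:R * (h / 2 ^+ N)).
  apply: (@grid_variation_le _ _ r kappa M N g n (m N)) => //.
  - move=> j jN; apply: le_trans (hM j); apply: ler_sum => k _.
    have gE (l : nat) : g (l * 2 ^ (N - j))%N = f (a + l%:R * (h / 2 ^+ j)).
      rewrite /g; congr (f (a + _)); rewrite natrM natrX.
      rewrite -{2}(subnK jN) exprD; field.
      by rewrite !gt_eqF.
    by rewrite !gE.
  - move=> i ilt; apply: le_truncn.
    rewrite ler_pM2r// ler_pM2r ?invr_gt0// lerD2r.
    by apply/ltW/(sortedP 0 ss); rewrite -ltn_predRL.
  - rewrite -(ler_nat R) natrX.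
    have xn : a <= x n <= a + h by apply: xI; rewrite /n; lia.
    apply: (@le_trans _ _ ((x n - a) / h * 2 ^+ N)).
      rewrite truncn_le mulr_ge0 ?(ltW (p2 N))// divr_ge0 ?(ltW h0)//.
      by rewrite subr_ge0; case/andP: xn.
    by rewrite ler_piMl ?(ltW (p2 N))// ler_pdivrMr// mul1r; lra.
suff hl l : 0 < l < 1 -> l * S `^ r^-1 <= B.
  have := powR_ge0 S r^-1; set v := _ `^ _ => v0.
  have [//|Bv] := leP v.
  (* if B < v, this l makes l v the midpoint of B and v *)
  have : 0 < (B + v) / (2 * v) < 1.
    by rewrite divr_gt0 ?mulr_gt0//= ?ltr_pdivrMr ?mulr_gt0//; lra.
  by move=> /hl; rewrite invfM mulrA mulfVK ?gt_eqF//; lra.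
move=> /andP[l0 l1].
have Sr : (S `^ r^-1) `^ r = S by rewrite -powRrM mulVf ?gt_eqF// powRr1.
rewrite -(ler_powR2r r0)//; last by rewrite mulr_ge0 ?powR_ge0 ?(ltW l0).
rewrite powRM ?powR_ge0 ?(ltW l0)// Sr mulr_sumr.
have near_all : \forall N \near \oo, forall i : 'I_n,
    l * mdist (f (x i)) (f (x i.+1)) <= mdist (f (y N i)) (f (y N i.+1)).
  apply: filter_forall => i.
  have xi1 : a <= x i.+1 <= a + h by apply: xI; rewrite -ltn_predRL.
  have xi : a <= x i <= a + h by apply: xI; apply: ltnW; rewrite -ltn_predRL.
  set z := mdist (f (x i)) (f (x i.+1)).
  have [z0|z0] := leP z 0.
    apply: nearW => N; apply: (@le_trans _ _ 0) => //; last exact: mdist_ge0.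
    by rewrite mulr_ge0_le0 // ltW.
  pose e := (1 - l) * z / 2.
  have e0 : 0 < e by rewrite /e divr_gt0// mulr_gt0// subr_gt0.
  have close k : a <= x k <= a + h ->
      \forall N \near \oo, mdist (f (x k)) (f (y N k)) < e.
    move=> xk; have [|d d0 hd] := within_continuous_mdist cf _ e0 (x := x k).
      by rewrite /= in_itv.
    have := near_half_pow_lt h d0; apply: filterS => N hN; apply: hd.
      rewrite /= in_itv/=; have /andP[ax xh] := xk.
      have /andP[yx1 _] := yx N k ax.
      rewrite (le_trans yx1 xh) andbT /y lerDl mulr_ge0// divr_ge0 ?ltW//.
    have /andP[ax _] := xk; have /andP[yx1 yx2] := yx N k ax.
    rewrite ger0_norm ?subr_ge0//; apply: le_lt_trans hN.
    apply: le_trans (ler_norm _); lra.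
  near=> N.
  have c1 : mdist (f (x i)) (f (y N i)) < e by near: N; exact: close.
  have c2 : mdist (f (x i.+1)) (f (y N i.+1)) < e by near: N; exact: close.
  have := metric_triangle (f (x i)) (f (y N i)) (f (x i.+1)).
  have := metric_triangle (f (y N i)) (f (y N i.+1)) (f (x i.+1)).
  rewrite (metric_sym (f (y N i.+1)) (f (x i.+1))) -/z.
  have : 2 * e = z - l * z by rewrite /e; field.
  move: c1 c2; lra.
have [N _ /(_ N (leqnn N)) hN] := near_all.
apply: le_trans (grid N); apply: ler_sum => i _.
rewrite -powRM ?mdist_ge0 ?(ltW l0)//.
by rewrite ler_powR2r ?mdist_ge0 ?mulr_ge0 ?mdist_ge0 ?(ltW l0).
Unshelve. all: end_near. Qed.

(** * Integrals and affine changes of variable *)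

Lemma lebesgue_measure_setT_gt0 (R : realType) :
  (0 < @lebesgue_measure R setT)%E.
Proof. by rewrite -set_itvNyy lebesgue_measure_itv /=; exact: ltry. Qed.

(** The integral of a nonnegative function is the supremum over the simple
functions below it, so it is monotone on all functions; this covers the
r-variation over [s, s + h], which enters as an arbitrary function of s. *)
Lemma ge0_le_integral_lower d (T : measurableType d) (R : realType)
    (mu : {measure set T -> \bar R}) (D : set T) (f g : T -> \bar R) :
  (forall x, D x -> 0 <= f x)%E -> (forall x, D x -> f x <= g x)%E ->
  (\int[mu]_(x in D) f x <= \int[mu]_(x in D) g x)%E.
Proof.
move=> f0 fg; have g0 x : D x -> (0 <= g x)%E.
  by move=> Dx; apply: le_trans (fg x Dx); exact: f0.
rewrite !ge0_integralE//; apply: le_ereal_sup => _ [h hf <-]; exists h => // x.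
by apply: le_trans (hf x) _; exact: lee_restrict.
Qed.

Section affine.
Variables (R : realType) (a b : R).
Hypothesis a0 : 0 < a.
Local Notation mu := (@lebesgue_measure R).

Let phi : measurableTypeR R -> measurableTypeR R := fun x => a * x + b.

Let mphi : measurable_fun setT phi.
Proof. by apply: measurable_funD => //; exact: measurable_funM. Qed.

(** By uniqueness of Lebesgue measure: a times the image measure agrees with it on
half-open intervals. *)
Lemma lebesgue_measure_affine (A : set R) : measurable A ->
  mu ((fun x => a * x + b) @^-1` A) = (a^-1%:E * mu A)%E.
Proof.
move=> mA.
pose nu := mscale (NngNum (ltW a0)) (pushforward mu phi).
have muE : mu A = nu mphi A.
  apply: lebesgue_measure_unique => // _ [[u v] _ <-].
  change (mu `]u, v]%classic = (a%:E * mu (phi @^-1` `]u, v]%classic))%E).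
  rewrite [X in (_ * mu X)%E](_ : _ = `](u - b) / a, (v - b) / a]%classic).
    rewrite !lebesgue_measure_itv /= !lte_fin ltr_pM2r ?invr_gt0//.
    rewrite ltrD2r; case: ifPn => _; rewrite ?mule0// -EFinM; congr EFin.
    by field; rewrite gt_eqF.
  apply/seteqP; split=> x /=; rewrite !in_itv /= /phi;
    rewrite ltr_pdivrMr// ler_pdivlMr//; lra.
rewrite muE; change (nu mphi A) with (a%:E * mu (phi @^-1` A))%E.
by rewrite muleA -EFinM mulVf ?gt_eqF// mul1e.
Qed.

Lemma integral_affine (D : set R) (g : R -> \bar R) :
  measurable D -> measurable_fun D g -> (forall y, D y -> 0 <= g y)%E ->
  (\int[mu]_(x in (fun x => (a * x + b)%R) @^-1` D) g (a * x + b)%R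
     = a^-1%:E * \int[mu]_(y in D) g y)%E.
Proof.
move=> mD mg g0.
rewrite -(ge0_integral_pushforward mphi mu)//; last first.
  by move=> y /set_mem; exact: g0.
have ai0 : 0 <= a^-1 by rewrite invr_ge0 ltW.
rewrite (_ : a^-1 = (NngNum ai0)%:num)// -ge0_integral_mscale//.
by apply: eq_measure_integral => //= A mA _; exact: lebesgue_measure_affine.
Qed.

Lemma ae_affine (P : R -> Prop) :
  {ae mu, forall x, P x} -> {ae mu, forall x, P (a * x + b)}.
Proof.
move=> [N [mN N0 PN]]; exists (phi @^-1` N); split.
- by rewrite -[X in measurable X]setTI; exact: mphi.
- by rewrite lebesgue_measure_affine// N0 mule0.
- by move=> x /= Px; exact: PN.
Qed.

End affine.

Lemma Lnorm_restrict d (T : measurableType d) (R : realType)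
    (mu : {measure set T -> \bar R}) (D : set T) (p : R) (f : T -> \bar R) :
  0 < p -> (forall x, D x -> 0 <= f x)%E ->
  Lnorm mu p%:E (f \_ D) = ((\int[mu]_(x in D) (f x `^ p)) `^ p^-1)%E.
Proof.
move=> p0 f0; rewrite unlock /=; congr (_ `^ _)%E.
rewrite [RHS]integral_mkcond; apply: eq_integral => x _.
rewrite !patchE; case: ifPn => [/set_mem Dx|_]; first by rewrite gee0_abs// f0.
by rewrite abse0 poweR0r// gt_eqF.
Qed.

(** * The r-variation in L^p *)

Lemma measurable_mdist_shift (R : realType) (X : metricType R) (T d : R)
    (f : R -> X) :
  0 <= d -> {within `[0, T], continuous f} ->
  measurable_fun `[0, T - d] (fun s => mdist (f s) (f (s + d))).
Proof.
move=> d0 cf; apply: subspace_continuous_measurable_fun => //.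
apply/subspace_continuousP => x; rewrite /= in_itv /= => /andP[x0 xT].
apply/cvgrPdist_lt => e e0.
have e20 : 0 < e / 2 by rewrite divr_gt0.
have [|d1 d10 h1] := within_continuous_mdist cf _ e20 (x := x).
  by rewrite /= in_itv /=; lra.
have [|d2 d20 h2] := within_continuous_mdist cf _ e20 (x := x + d).
  by rewrite /= in_itv /=; lra.
rewrite near_withinE; exists (Num.min d1 d2).
  by rewrite /= lt_min d10 d20.
move=> y /=; rewrite lt_min in_itv /= => /andP[y1 y2] /andP[y0 yT].
have c1 : mdist (f x) (f y) < e / 2.
  by apply: h1 => //; rewrite /= in_itv /=; lra.
have c2 : mdist (f (x + d)) (f (y + d)) < e / 2.
  apply: h2; first by rewrite /= in_itv /=; lra.
  by rewrite opprD addrACA subrr addr0.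
have := metric_triangle (f x) (f y) (f (x + d)).
have := metric_triangle (f y) (f (y + d)) (f (x + d)).
have := metric_triangle (f y) (f x) (f (y + d)).
have := metric_triangle (f x) (f (x + d)) (f (y + d)).
rewrite (metric_sym (f y) (f x)) (metric_sym (f (y + d)) (f (x + d))).
by move: c1 c2; rewrite ltr_norml; lra.
Qed.

(** Translation by b carries [0, T - h] into [0, T - d], as b + d <= h: the L^p norm
of every dyadic increment of size d is controlled by the modulus at d. *)
Lemma integral_mdist_shift_le (R : realType) (X : metricType R)
    (T b d h p : R) (f : R -> X) :
  0 <= b -> 0 <= d -> b + d <= h -> {within `[0, T], continuous f} ->
  (\int[@lebesgue_measure R]_(s in `[0%R, (T - h)%R])
      (mdist (f (s + b)%R) (f (s + b + d)%R) `^ p)%:E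
   <= \int[@lebesgue_measure R]_(s in `[0%R, (T - d)%R])
      (mdist (f s) (f (s + d)%R) `^ p)%:E)%E.
Proof.
move=> b0 d0 bdh cf.
pose g s := (mdist (f s) (f (s + d)%R) `^ p)%:E.
have mg : measurable_fun `[0, T - d] g.
  apply/measurable_EFinP.
  exact: (measurableT_comp (measurable_powR _)) (measurable_mdist_shift d0 cf).
have g0 y : (0 <= g y)%E by rewrite lee_fin powR_ge0.
have sub : `[b, T - h + b] `<=` `[0, T - d].
  by move=> x /=; rewrite !in_itv /= => /andP[? ?]; lra.
apply: (@le_trans _ _ (\int[@lebesgue_measure R]_(s in `[b, (T - h + b)%R]) g s)%E);
   last by apply: ge0_subset_integral.
rewrite le_eqVlt; apply/orP; left; apply/eqP.
have := @integral_affine R 1 b ltr01 `[b, T - h + b] g.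
rewrite invr1 mul1e => <- //; last by apply: measurable_funS mg.
rewrite (_ : _ @^-1` _ = `[0, T - h]%classic).
  by apply: eq_integral => x _; rewrite mul1r.
by apply/seteqP; split=> x /=; rewrite !in_itv /= => /andP[? ?]; lra.
Qed.

Lemma r_variation_ge0 (R : realType) (X : metricType R) (r : R) (f : R -> X)
    (I : set R) : (0 <= r_variation r f I)%E.
Proof.
apply: le_trans (ereal_sup_ubound _); last by exists [::] => //; split.
by rewrite lee_fin powR_ge0.
Qed.

(** If the series on the right has a finite sum g, then each level is bounded by
g kappa^(2jp), and the power mean inequality with exponent p/r turns this into
the hypothesis of [r_variation_le_dyadic] with M = g^(1/p). *)
Lemma poweR_r_variation_le (R : realType) (X : metricType R) (f : R -> X)
    (r p kappa a h : R) :
  1 <= r -> r <= p -> 0 < kappa < 1 -> 0 < h ->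
  {within `[a, a + h], continuous f} ->
  (r_variation r f `[a, (a + h)%R] `^ p <=
   ((2 / (1 - kappa) ^+ 2) `^ p)%:E *
   \sum_(j <oo) ((2 ^+ j) `^ (p / r - 1) / (kappa ^+ (2 * j)) `^ p *
     \sum_(k < 2 ^ j) mdist (f (a + k%:R * (h / 2 ^+ j)))
                            (f (a + k.+1%:R * (h / 2 ^+ j))) `^ p)%R%:E)%E.
Proof.
move=> r1 rp /[dup] k01 /andP[k0 k1] h0 cf.
have r0 : 0 < r by exact: lt_le_trans r1.
have p0 : 0 < p by exact: lt_le_trans rp.
set C := 2 / _.
have C0 : 0 < C by rewrite divr_gt0// exprn_gt0// subr_gt0.
pose x j k := mdist (f (a + k%:R * (h / 2 ^+ j))) (f (a + k.+1%:R * (h / 2 ^+ j))).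
have x0 j k : 0 <= x j k by exact: mdist_ge0.
have kj0 j : 0 < kappa ^+ (2 * j) by rewrite exprn_gt0.
pose u j := ((2 ^+ j) `^ (p / r - 1) / (kappa ^+ (2 * j)) `^ p *
    \sum_(k < 2 ^ j) x j k `^ p)%:E.
rewrite (_ : limn _ = \sum_(j <oo) u j)%E//.
have u0 j : (0 <= u j)%E.
  rewrite lee_fin mulr_ge0// ?divr_ge0 ?powR_ge0//.
  by apply: sumr_ge0 => k _; exact: powR_ge0.
have S0 : (0 <= \sum_(j <oo) u j)%E by exact: nneseries_ge0.
have [Sy|Sfin] := eqVneq (\sum_(j <oo) u j)%E +oo%E.
  by rewrite Sy gt0_muley ?leey// lte_fin powR_gt0.
have : (\sum_(j <oo) u j)%E \is a fin_num by rewrite ge0_fin_numE// ltey.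
move=> /fineK; set g := fine _ => gE; rewrite -gE.
have g0 : 0 <= g by rewrite -lee_fin gE.
have ujg j : (u j <= g%:E)%E.
  rewrite gE; apply: le_trans (nneseries_lim_ge j.+1 _) => //.
  by rewrite big_nat_recr //= leeDr// sume_ge0.
have gp : (g `^ p^-1) `^ p = g by rewrite -powRrM mulVf ?gt_eqF// powRr1.
rewrite -EFinM -[in leRHS]gp -powRM ?powR_ge0 ?(ltW C0)//.
rewrite -poweR_EFin lee_poweR2r//.
- apply: r_variation_le_dyadic => // [|j]; first exact: powR_ge0.
  have s0 : 0 <= \sum_(k < 2 ^ j) x j k `^ r.
    by apply: sumr_ge0 => k _; exact: powR_ge0.
  rewrite -(@ler_powR2r _ (p / r)) ?divr_gt0 ?powR_ge0//.
  rewrite -[leRHS]powRrM mulrCA mulfV ?gt_eqF// mulr1.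
  rewrite powRM ?powR_ge0 ?(ltW (kj0 j))// gp.
  have pr1 : 1 <= p / r by rewrite ler_pdivlMr// mul1r.
  apply: (le_trans (power_mean_le (2 ^ j) pr1 (fun k => powR_ge0 (x j k) r))).
  have := ujg j; rewrite lee_fin mulrAC ler_pdivrMr ?powR_gt0//.
  rewrite natrX; under [X in _ -> _ * X <= _]eq_bigr => k _.
    by rewrite -powRrM mulrCA mulfV ?gt_eqF// mulr1; over.
  by [].
- exact: r_variation_ge0.
- by rewrite lee_fin mulr_ge0 ?powR_ge0 ?ltW.
Qed.

(** Here nu = 2^(1/r) < mu. The ratio nu / mu is kappa^3: a factor kappa^2 is spent
on the level bounds of [r_variation_le_dyadic], and the remaining factor kappa
makes the series over the levels converge. *)
Section variation_Lnorm.
Context (R : realType) (X : metricType R) (f : R -> X) (T h K r kappa nu mu : R).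
Hypotheses (r1 : 1 <= r) (k01 : 0 < kappa < 1) (K0 : 0 <= K) (h0 : 0 < h).
Hypotheses (mu0 : 0 < mu) (nuE : nu = kappa ^+ 3 * mu) (nur : nu `^ r = 2).
Hypothesis cf : {within `[0, T], continuous f}.

Let dist d (s : R) := (mdist (f s) (f (s + d)%R))%:E.
Let C := 2 / (1 - kappa) ^+ 2.

Lemma grid_shift (s : R) (j k : nat) :
  s + k.+1%:R * (h / 2 ^+ j) = s + k%:R * (h / 2 ^+ j) + h / 2 ^+ j.
Proof. by rewrite -[k.+1%:R]natr1 mulrDl mul1r addrA. Qed.

Lemma grid_ge0 (j k : nat) : 0 <= k%:R * (h / 2 ^+ j).
Proof. by rewrite mulr_ge0// divr_ge0// ?exprn_ge0// ltW. Qed.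

Lemma grid_le (j k : nat) : (k < 2 ^ j)%N ->
  k%:R * (h / 2 ^+ j) + h / 2 ^+ j <= h.
Proof.
move=> kj; have -> : k%:R * (h / 2 ^+ j) + h / 2 ^+ j = k.+1%:R * (h / 2 ^+ j).
  by rewrite -[k.+1%:R]natr1 mulrDl mul1r.
rewrite mulrA ler_pdivrMr ?exprn_gt0// mulrC ler_pM2l// -natrX ler_nat//.
Qed.

(** Integrating [poweR_r_variation_le] in s: the 2^j increments of level j
contribute 2^j (K mu^-j)^p, and the total coefficient of level j is kappa^(jp). *)
Lemma Lnorm_variation_fin (p : R) : r <= p ->
  (forall j, (Lnorm (@lebesgue_measure R) p%:E
     (dist (h / 2 ^+ j) \_ `[0%R, (T - h / 2 ^+ j)%R])
     <= (K / mu ^+ j)%:E)%E) ->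
  (Lnorm (@lebesgue_measure R) p%:E
     ((fun s => r_variation r f `[s, (s + h)%R]) \_ `[0%R, (T - h)%R])
     <= (C / (1 - kappa) * K)%:E)%E.
Proof.
move=> rp hK; have /andP[k0 k1] := k01.
have r0 : 0 < r by exact: lt_le_trans r1.
have p1 : 1 <= p by exact: le_trans rp.
have p0 : 0 < p by exact: lt_le_trans rp.
have C0 : 0 < C by rewrite divr_gt0// exprn_gt0// subr_gt0.
have k1' : 0 < 1 - kappa by rewrite subr_gt0.
have Ck0 : 0 <= C / (1 - kappa) by rewrite divr_ge0 ?ltW.
have nu0 : 0 < nu by rewrite nuE mulr_gt0// exprn_gt0.
rewrite Lnorm_restrict//; last by move=> *; exact: r_variation_ge0.
pose c j := (2 ^+ j) `^ (p / r - 1) / (kappa ^+ (2 * j)) `^ p : R.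
have c0 j : 0 <= c j by rewrite divr_ge0// powR_ge0.
pose x (j k : nat) s := mdist (f (s + k%:R * (h / 2 ^+ j)))
                  (f (s + k%:R * (h / 2 ^+ j) + h / 2 ^+ j)) `^ p.
have x0 j k s : 0 <= x j k s by exact: powR_ge0.
pose G s := (\sum_(j <oo) ((c j)%:E * \sum_(k < 2 ^ j) (x j k s)%:E))%E.
have mx j (k : 'I_(2 ^ j)) :
    measurable_fun `[0, T - h] (EFin \o (x j k)).
  have bd := grid_le (ltn_ord k); have b0 := grid_ge0 j k.
  have d0 : 0 <= h / 2 ^+ j by rewrite divr_ge0 ?exprn_ge0// ltW.
  set b := k%:R * _ in bd b0.
  apply/measurable_EFinP; apply: (measurableT_comp (measurable_powR p)).
  have comp := @measurable_comp _ _ _ R R R `[0, T - h / 2 ^+ j]%classic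
    (fun s => mdist (f s) (f (s + h / 2 ^+ j))) `[0, T - h]%classic (+%R^~ b).
  apply: comp => //.
  - by move=> _ [s /= + <-]; rewrite !in_itv /= => /andP[? ?]; lra.
  - exact: measurable_mdist_shift.
  - exact: measurable_funD.
have term0 j s : (0 <= (c j)%:E * \sum_(k < 2 ^ j) (x j k s)%:E)%E.
  by rewrite mule_ge0 ?lee_fin// sume_ge0// => k _; rewrite lee_fin.
have mterm j : measurable_fun `[0, T - h]
    (fun s => (c j)%:E * \sum_(k < 2 ^ j) (x j k s)%:E)%E.
  by apply: emeasurable_funM => //; apply: emeasurable_sum => k; exact: mx.
have mG : measurable_fun `[0, T - h] G.
  by apply: (@ge0_emeasurable_sum _ _ _ _ _ predT) => // j s _ _; exact: term0.
have intx j (k : 'I_(2 ^ j)) :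
    (\int[@lebesgue_measure R]_(s in `[0%R, (T - h)%R]) (x j k s)%:E
     <= ((K / mu ^+ j) `^ p)%:E)%E.
  apply: le_trans (integral_mdist_shift_le _ _ _ _ cf) _.
  - exact: grid_ge0.
  - by rewrite divr_ge0 ?exprn_ge0// ltW.
  - exact: grid_le.
  have := hK j; rewrite Lnorm_restrict//; last by move=> s _; rewrite lee_fin mdist_ge0.
  rewrite -(lee_poweR2r p0) ?poweR_ge0//; last first.
    by rewrite lee_fin divr_ge0// exprn_ge0// ltW.
  rewrite -poweRrM mulVf ?gt_eqF// poweRe1; first exact.
  by apply: integral_ge0 => s _; exact: poweR_ge0.
have intG : (\int[@lebesgue_measure R]_(s in `[0%R, (T - h)%R]) G s
    <= (K `^ p / (1 - kappa))%:E)%E.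
  rewrite integral_nneseries//.
  apply: le_trans (nneseries_geometric_le (powR_ge0 K p) k01).
  apply: lee_nneseries => j _.
    by move=> _; apply: integral_ge0 => s _; exact: term0.
  rewrite ge0_integralZl_EFin//; last first.
  - by apply: emeasurable_sum => k; exact: mx.
  - by move=> s _; apply: sume_ge0 => k _; rewrite lee_fin.
  rewrite ge0_integral_sum//; last 2 first.
  - by move=> k; exact: mx.
  - by move=> k s _; rewrite lee_fin.
  apply: (@le_trans _ _ ((c j)%:E * \sum_(k < 2 ^ j) ((K / mu ^+ j) `^ p)%:E)%E).
    by rewrite lee_wpmul2l ?lee_fin//; apply: lee_sum => k _; exact: intx.
  rewrite sumEFin -EFinM lee_fin sumr_const card_ord -[_ *+ _]mulr_natl natrX.
  have E : c j * (2 ^+ j * (K / mu ^+ j) `^ p) = (kappa ^+ j) `^ p * K `^ p.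
    have n2 : 2 ^+ j = (nu ^+ j) `^ r :> R.
      by rewrite -nur -!powR_mulrn ?powR_ge0 ?(ltW nu0)// powRAC.
    rewrite /c powRB; last by apply/implyP => _; rewrite gt_eqF// exprn_gt0.
    rewrite powRr1 ?exprn_ge0// {1}n2 -[(nu ^+ j) `^ r `^ _]powRrM.
    have -> : r * (p / r) = p by field; rewrite gt_eqF.
    have muj : 0 < mu ^+ j by rewrite exprn_gt0.
    have kj : 0 < kappa ^+ (2 * j) by rewrite exprn_gt0.
    have -> : nu ^+ j = kappa ^+ j * kappa ^+ (2 * j) * mu ^+ j.
      by rewrite nuE exprMn -exprM -exprD; congr (_ ^+ _ * _); lia.
    have -> : K `^ p = (K / mu ^+ j) `^ p * (mu ^+ j) `^ p.
      by rewrite -powRM ?divr_ge0 ?(ltW muj)// divfK ?gt_eqF.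
    set Kj := (K / _) `^ p.
    rewrite !powRM ?mulr_ge0 ?exprn_ge0 ?(ltW k0) ?(ltW mu0)//.
    by field; rewrite !gt_eqF ?powR_gt0 ?exprn_gt0.
  rewrite E mulrC ler_wpM2l ?powR_ge0//.
  by apply: ge1r_powR; rewrite // exprn_gt0//= exprn_ile1 ?ltW.
have V0 s : (0 <= r_variation r f `[s, (s + h)%R])%E by exact: r_variation_ge0.
rewrite -(lee_poweR2r p0) ?poweR_ge0//; last first.
  by rewrite lee_fin mulr_ge0.
rewrite -poweRrM mulVf ?gt_eqF// poweRe1; last first.
  by apply: integral_ge0 => s _; exact: poweR_ge0.
apply: (@le_trans _ _ (\int[@lebesgue_measure R]_(s in `[0%R, (T - h)%R])
    ((C `^ p)%:E * G s))%E).
  apply: ge0_le_integral_lower => s; first by move=> _; exact: poweR_ge0.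
  rewrite /= in_itv /= => /andP[s0 sT].
  apply: le_trans (poweR_r_variation_le r1 rp k01 h0 _) _.
    apply: continuous_subspaceW cf => y /=; rewrite !in_itv /= => /andP[? ?].
    lra.
  rewrite le_eqVlt; apply/orP; left; apply/eqP; congr (_ * _)%E.
  apply: eq_eseriesr => j _; rewrite sumEFin -EFinM; congr (_ * _)%:E.
  by apply: eq_bigr => k _; rewrite grid_shift.
rewrite ge0_integralZl_EFin ?powR_ge0//; last first.
  by move=> s _; exact: nneseries_ge0.
apply: le_trans (lee_wpmul2l _ intG) _; first by rewrite lee_fin powR_ge0.
rewrite -EFinM poweR_EFin lee_fin [leRHS]powRM//.
rewrite [X in _ <= X * _]powRM ?invr_ge0 ?(ltW C0) ?(ltW k1')//.
rewrite mulrCA [leRHS]mulrC ler_wpM2l ?powR_ge0// ler_wpM2l ?powR_ge0//.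
by apply: le1r_powR => //; rewrite invf_ge1 ?subr_gt0//; lra.
Qed.

(** For almost every s all the dyadic increments of [s, s + h] obey the essential
bound at once, since there are countably many of them and translations preserve
null sets. *)
Lemma Lnorm_variation_infty :
  (forall j, (Lnorm (@lebesgue_measure R) +oo
     (dist (h / 2 ^+ j) \_ `[0%R, (T - h / 2 ^+ j)%R])
     <= (K / mu ^+ j)%:E)%E) ->
  (Lnorm (@lebesgue_measure R) +oo
     ((fun s => r_variation r f `[s, (s + h)%R]) \_ `[0%R, (T - h)%R])
     <= (C / (1 - kappa) * K)%:E)%E.
Proof.
move=> hK; have /andP[k0 k1] := k01.
have r0 : 0 < r by exact: lt_le_trans r1.
have C0 : 0 < C by rewrite divr_gt0// exprn_gt0// subr_gt0.
have CK : C * K <= C / (1 - kappa) * K.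
  rewrite ler_wpM2r// ler_pMr// invf_ge1 ?subr_gt0//; lra.
rewrite unlock lebesgue_measure_setT_gt0; apply/ess_supP.
have aejk : {ae @lebesgue_measure R, forall s, forall j k : nat,
    (abse ((dist (h / 2 ^+ j) \_ `[0%R, (T - h / 2 ^+ j)%R])
            (1 * s + k%:R * (h / 2 ^+ j))%R) <= (K / mu ^+ j)%:E)%E}.
  apply/ae_foralln => j; apply/ae_foralln => k.
  pose P s := (abse ((dist (h / 2 ^+ j) \_ `[0%R, (T - h / 2 ^+ j)%R]) s)
    <= (K / mu ^+ j)%:E)%E.
  apply: (@ae_affine R 1 _ ltr01 P); apply/ess_supP.
  by have := hK j; rewrite unlock lebesgue_measure_setT_gt0.
move: aejk; apply: (@filterS _ _ (ae_filter_ringOfSetsType _)) => s hs /=.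
rewrite patchE; case: ifPn => [/set_mem|_]; last first.
  by rewrite abse0 lee_fin mulr_ge0// divr_ge0 ?(ltW C0)// subr_ge0 ltW.
rewrite /= in_itv /= => /andP[s0 sT].
rewrite gee0_abs ?r_variation_ge0//; apply: (@le_trans _ _ (C * K)%:E); last first.
  by rewrite lee_fin.
apply: r_variation_le_dyadic => // [|j].
  apply: continuous_subspaceW cf => y /=; rewrite !in_itv /= => /andP[? ?]; lra.
have mj : 0 < mu ^+ j by rewrite exprn_gt0.
apply: (@le_trans _ _ (\sum_(k < 2 ^ j) (K / mu ^+ j) `^ r)).
  apply: ler_sum => k _; rewrite ler_powR2r ?mdist_ge0 ?divr_ge0 ?(ltW mj)//.
  have := hs j k; rewrite mul1r patchE mem_set; last first.
    have := grid_le (ltn_ord k); have := grid_ge0 j k.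
    by rewrite /= in_itv /=; set b := _ * _; move=> ? ?; lra.
  by rewrite gee0_abs /dist ?lee_fin ?mdist_ge0// grid_shift.
rewrite sumr_const card_ord -[_ *+ _]mulr_natl natrX -nur.
have nu0 : 0 < nu by rewrite nuE mulr_gt0// exprn_gt0.
rewrite -(powR_mulrn j (powR_ge0 nu r)) powRAC powR_mulrn ?(ltW nu0)//.
rewrite -powRM ?divr_ge0 ?exprn_ge0 ?(ltW nu0) ?(ltW mu0)//.
rewrite ler_powR2r ?mulr_ge0 ?invr_ge0 ?exprn_ge0 ?(ltW nu0) ?(ltW mu0) ?(ltW k0)//.
have -> : nu ^+ j = kappa ^+ j * kappa ^+ (2 * j) * mu ^+ j.
  by rewrite nuE exprMn -exprM -exprD; congr (_ ^+ _ * _); lia.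
rewrite [leLHS]mulrCA mulfK ?gt_eqF// ler_wpM2l//.
by rewrite ler_piMl ?exprn_ge0 ?exprn_ile1 ?ltW.
Qed.

End variation_Lnorm.

(** For h <= t the increments of size h / 2^j are governed by the modulus at
t / 2^j, which is a supremum over all smaller sizes. *)
Lemma omega_variation_le (R : realType) (r kappa nu mu : R) (p : \bar R) :
  1 <= r -> (r%:E <= p)%E -> 0 < kappa < 1 -> 0 < mu ->
  nu = kappa ^+ 3 * mu -> nu `^ r = 2 ->
  forall (X : metricType R) (f : R -> X) (T t K : R),
  {within `[0, T], continuous f} -> 0 <= K ->
  (forall j, (omega T p (fun s t => (mdist (f s) (f t))%:E) (t / 2 ^+ j)
     <= (K / mu ^+ j)%:E)%E) ->
  (omega T p (fun s t => r_variation r f `[s, t]) t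
     <= (2 / (1 - kappa) ^+ 3 * K)%:E)%E.
Proof.
move=> r1 rp k01 mu0 nuE nur X f T t K cf K0 hK.
apply: ge_ereal_sup => _ [h /= + <-]; rewrite in_itv /= => /andP[h0 ht].
have hK' j : (Lnorm (@lebesgue_measure R) p
   ((fun s => (mdist (f s) (f (s + h / 2 ^+ j)%R))%:E)
      \_ `[0%R, (T - h / 2 ^+ j)%R]) <= (K / mu ^+ j)%:E)%E.
  apply: le_trans (hK j); apply: ereal_sup_ubound; exists (h / 2 ^+ j) => //=.
  by rewrite in_itv /= divr_gt0 ?exprn_gt0//= ler_pM2r// invr_gt0 exprn_gt0.
have -> : 2 / (1 - kappa) ^+ 3 = 2 / (1 - kappa) ^+ 2 / (1 - kappa).
  by field; case/andP: k01 => _ k1; rewrite gt_eqF// subr_gt0.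
clear hK; case: p rp hK' => [p| |] // rp hK'.
- exact: (Lnorm_variation_fin r1 k01 K0 h0 mu0 nuE nur cf).
- exact: (Lnorm_variation_infty r1 k01 K0 h0 mu0 nuE nur cf).
Qed.

(** * From moduli to Besov norms *)

Section omega.
Context (R : realType) (T : R) (p : \bar R).
Implicit Type chi : R -> R -> \bar R.

Lemma omega_ge0 chi t : 0 < t -> (0 <= omega T p chi t)%E.
Proof.
move=> t0; pose chi_t := (fun s : R => chi s (s + t)) \_ `[0%R, T - t].
apply: (@le_trans _ _ (Lnorm (@lebesgue_measure R) p chi_t)).
  exact: Lnorm_ge0.
by apply: ereal_sup_ubound; exists t; rewrite //= in_itv /= t0 lexx.
Qed.

Lemma omega_nondecreasing chi : {homo omega T p chi : t u / t <= u >-> (t <= u)%E}.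
Proof.
move=> t u tu; apply: le_ereal_sup; apply: image_subset => h /=.
by rewrite !in_itv /= => /andP[-> /le_trans]; apply.
Qed.

(** The modulus is nondecreasing, so its superlevel sets are intervals. *)
Lemma measurable_omega chi (D : set R) :
  measurable D -> measurable_fun D (omega T p chi).
Proof.
move=> mD; apply: (measurability _ (ErealGenOInfty.measurableE R)) => //.
move=> _ [_ [x ->] <-]; apply: measurableI => //.
apply: is_interval_measurable => s t /=; rewrite !in_itv /= !andbT => xs _ u.
by move=> /andP[su _]; rewrite in_itv /= andbT (lt_le_trans xs)// omega_nondecreasing.
Qed.

End omega.

(** The integrand of the Besov norm with finite q. *)
Definition besov_density {R : realType} (T alpha : R) (p : \bar R) (q : R)
    (chi : R -> R -> \bar R) (t : R) : \bar R :=
  ((omega T p chi t * ((t `^ alpha)^-1)%:E) `^ q * (t^-1)%:E)%E.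

Lemma measurable_besov_density (R : realType) (T alpha : R) (p : \bar R) (q : R)
    (chi : R -> R -> \bar R) (b : R) :
  measurable_fun `]0, b] (besov_density T alpha p q chi).
Proof.
apply: emeasurable_funM.
  apply: (measurableT_comp (measurable_poweR _)).
  apply: emeasurable_funM; first exact: measurable_omega.
  apply: (eq_measurable_fun (fun t => (t `^ (- alpha))%:E)).
    by move=> t _; rewrite powRN.
  by apply/measurable_EFinP; exact: measurable_funTS (measurable_powR _).
apply: (eq_measurable_fun (fun t => (t `^ (-1))%:E)).
  move=> t /set_mem /=; rewrite in_itv /= => /andP[t0 _].
  by rewrite powR_inv1// ltW.
by apply/measurable_EFinP; exact: measurable_funTS (measurable_powR _).
Qed.

Lemma besov_density_ge0 (R : realType) (T alpha : R) (p : \bar R) (q : R)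
    (chi : R -> R -> \bar R) (t : R) :
  0 < t -> (0 <= besov_density T alpha p q chi t)%E.
Proof. by move=> t0; rewrite mule_ge0 ?poweR_ge0// lee_fin invr_ge0 ltW. Qed.

Lemma integral_dilation_le (R : realType) (T a : R) (g : R -> \bar R) :
  1 <= a -> 0 < T -> measurable_fun `]0, T] g ->
  (forall t, 0 < t -> (0 <= g t)%E) ->
  (\int[@lebesgue_measure R]_(t in `]0%R, T]) g (t / a)%R
     <= a%:E * \int[@lebesgue_measure R]_(t in `]0%R, T]) g t)%E.
Proof.
move=> a1 T0 mg g0; have a0 : 0 < a by exact: lt_le_trans a1.
have ia0 : 0 < a^-1 by rewrite invr_gt0.
have sub : `]0, T / a] `<=` `]0, T].
  move=> t /=; rewrite !in_itv /= => /andP[-> /le_trans]; apply.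
  by rewrite ler_pdivrMr// ler_peMr// ltW.
have := @integral_affine R a^-1 0 ia0 `]0, T / a]%classic g.
rewrite invrK (_ : _ @^-1` _ = `]0, T]%classic); last first.
  apply/seteqP; split=> t /=; rewrite !in_itv /= addr0 mulrC;
    by rewrite ler_pM2r// pmulr_lgt0.
under [in X in _ -> X = _]eq_integral do rewrite addr0 mulrC.
move=> ->//.
- rewrite lee_wpmul2l ?lee_fin ?(ltW a0)//.
  apply: ge0_subset_integral => // t /=; rewrite in_itv /= => /andP[t0 _].
  exact: g0.
- by apply: measurable_funS mg.
- by move=> t /=; rewrite in_itv /= => /andP[t0 _]; exact: g0.
Qed.

(** The passage from moduli to Besov norms uses only the implication between the
dyadic values of one modulus and the other modulus, so it is stated for two
arbitrary two-parameter functions. *)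
Section besov_transfer.
Context (R : realType) (T alpha C mu : R) (p : \bar R).
Context (phi psi : R -> R -> \bar R).
Hypotheses (T0 : 0 < T) (C0 : 0 < C) (mu0 : 0 < mu).
Hypothesis (mu_alpha : mu < 2 `^ alpha).
Hypothesis dyadic_bound : forall t K, 0 < t -> 0 <= K ->
  (forall j, (omega T p phi (t / 2 ^+ j) <= (K / mu ^+ j)%:E)%E) ->
  (omega T p psi t <= (C * K)%:E)%E.

Let lam := mu / 2 `^ alpha.

Let lam01 : 0 < lam < 1.
Proof. by rewrite divr_gt0 ?powR_gt0//= ltr_pdivrMr ?powR_gt0// mul1r. Qed.

Let p2_gt0 j : 0 < 2 ^+ j :> R. Proof. by rewrite exprn_gt0. Qed.

(** Null sets are preserved by dilations, so almost every t satisfies the essential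
bound at all the points t / 2^j at once. *)
Lemma besov_norm_transfer_infty :
  (besov_norm T alpha p +oo psi <= C%:E * besov_norm T alpha p +oo phi)%E.
Proof.
rewrite /besov_norm.
set w := fun t => (omega T p phi t * _)%E.
set v := fun t => (omega T p psi t * _)%E.
have w0 t : (0 <= (w \_ `]0%R, T]) t)%E.
  apply: erestrict_ge0 => u /=; rewrite in_itv /= => /andP[u0 _].
  by rewrite mule_ge0 ?omega_ge0// lee_fin invr_ge0 powR_ge0.
set N := ess_sup (@lebesgue_measure R) (w \_ `]0%R, T]).
have N0 : (0 <= N)%E.
  by apply: ess_sup_gee; [exact: lebesgue_measure_setT_gt0|exact: aeW].
have [->|Nfin] := eqVneq N +oo%E; first by rewrite gt0_muley ?lte_fin// leey.
have : N \is a fin_num by rewrite ge0_fin_numE// ltey.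
move=> /fineK; set n := fine N => nN.
have n0 : 0 <= n by rewrite -lee_fin nN.
have aew : {ae @lebesgue_measure R, forall t, forall j,
    ((w \_ `]0%R, T]) ((2 ^+ j)^-1 * t + 0)%R <= N)%E}.
  apply/ae_foralln => j; pose P t := ((w \_ `]0%R, T]) t <= N)%E.
  apply: (@ae_affine R (2 ^+ j)^-1 0 _ P); first by rewrite invr_gt0.
  exact: ess_sup_ge.
apply/ess_supP; move: aew; apply: (@filterS _ _ (ae_filter_ringOfSetsType _)).
move=> t ht; rewrite patchE; case: ifPn => [/set_mem|_]; last first.
  by rewrite mule_ge0// lee_fin ltW.
rewrite /= in_itv /= => /andP[t0 tT].
have ta0 : 0 < t `^ alpha by exact: powR_gt0.
rewrite -nN -EFinM lee_mulV// -mulrA; apply: dyadic_bound => // [|j].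
  by rewrite mulr_ge0// ltW.
have s0 : 0 < t / 2 ^+ j by rewrite divr_gt0.
have := ht j; rewrite addr0 mulrC patchE mem_set; last first.
  rewrite /= in_itv /= s0 (le_trans _ tT)//.
  by rewrite ler_pdivrMr// ler_peMr ?(ltW t0)// exprn_ege1// ler1n.
rewrite -nN lee_mulV ?powR_gt0// => /le_trans; apply; rewrite lee_fin.
rewrite -[leRHS]mulrA ler_wpM2l// powRM ?invr_ge0 ?(ltW t0) ?(ltW (p2_gt0 _))//.
rewrite ler_wpM2l ?(ltW ta0)//.
have -> : (2 ^+ j)^-1 `^ alpha = ((2 `^ alpha) ^+ j)^-1 :> R.
  by rewrite powRV ?(ltW (p2_gt0 _))// -powR_mulrn// powRAC powR_mulrn ?powR_ge0.
rewrite lef_pV2 ?posrE ?exprn_gt0 ?powR_gt0//.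
by rewrite lerXn2r ?nnegrE ?powR_ge0 ?ltW.
Qed.

(** The hypothesis on the moduli is applied with K the l^q norm of the sequence
mu^j Omega(t / 2^j), which dominates each of its terms for every q > 0. *)
Lemma omega_le_series (q t : R) : 0 < q -> 0 < t ->
  (omega T p psi t `^ q <= (C `^ q)%:E *
     \sum_(j <oo) (((mu ^+ j) `^ q)%:E * omega T p phi (t / 2 ^+ j) `^ q))%E.
Proof.
move=> q0 t0; set S := (\sum_(j <oo) _)%E.
have om0 j : (0 <= omega T p phi (t / 2 ^+ j))%E.
  by apply: omega_ge0; rewrite divr_gt0.
have u0 j : (0 <= ((mu ^+ j) `^ q)%:E * omega T p phi (t / 2 ^+ j) `^ q)%E.
  by rewrite mule_ge0 ?poweR_ge0// lee_fin powR_ge0.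
have S0 : (0 <= S)%E by exact: nneseries_ge0.
have [->|Sfin] := eqVneq S +oo%E.
  by rewrite gt0_muley ?leey// lte_fin powR_gt0.
have : S \is a fin_num by rewrite ge0_fin_numE// ltey.
move=> /fineK; set g := fine S => gE.
have g0 : 0 <= g by rewrite -lee_fin gE.
pose K := g `^ q^-1.
have K0 : 0 <= K by exact: powR_ge0.
have Kq : K `^ q = g by rewrite /K -powRrM mulVf ?gt_eqF// powRr1.
rewrite -gE -Kq -EFinM -powRM ?(ltW C0)// -poweR_EFin.
rewrite lee_poweR2r ?omega_ge0// ?lee_fin ?mulr_ge0 ?(ltW C0)//.
apply: dyadic_bound => // j; have mj : 0 < mu ^+ j by rewrite exprn_gt0.
rewrite -lee_mulV ?invr_gt0// invrK.
rewrite -(lee_poweR2r q0) ?mule_ge0 ?lee_fin ?(ltW mj)//.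
rewrite poweR_EFin Kq gE poweRM ?lee_fin ?(ltW mj)// poweR_EFin muleC.
apply: le_trans (nneseries_lim_ge j.+1 _) => //.
by rewrite big_nat_recr //= leeDr// sume_ge0.
Qed.

(** Here t^-alpha is 2^(-j alpha) (t / 2^j)^-alpha, which turns mu into lam, and 1/t
is 2^-j / (t / 2^j), a factor that the dilation of the integral gives back. *)
Lemma besov_density_le_series (q t : R) : 0 < q -> 0 < t ->
  (besov_density T alpha p q psi t <= (C `^ q)%:E *
     \sum_(j <oo) (((lam `^ q) ^+ j / 2 ^+ j)%:E *
                   besov_density T alpha p q phi (t / 2 ^+ j)))%E.
Proof.
move=> q0 t0.
have om0 j : (0 <= omega T p phi (t / 2 ^+ j))%E.
  by apply: omega_ge0; rewrite divr_gt0.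
have ta0 : 0 < t `^ alpha by exact: powR_gt0.
pose m := ((t `^ alpha)^-1) `^ q * t^-1.
have m0 : 0 <= m by rewrite mulr_ge0 ?powR_ge0// invr_ge0 ltW.
have densE chi : (0 <= omega T p chi t)%E ->
    (besov_density T alpha p q chi t = m%:E * omega T p chi t `^ q)%E.
  move=> o0; rewrite /besov_density poweRM// ?lee_fin ?invr_ge0 ?(ltW ta0)//.
  by rewrite poweR_EFin -muleA -EFinM muleC.
rewrite densE ?omega_ge0//.
apply: le_trans (lee_wpmul2l _ (omega_le_series q0 t0)) _; first by rewrite lee_fin.
rewrite muleCA lee_wpmul2l ?lee_fin ?powR_ge0//.
rewrite -nneseriesZl; last first.
  by move=> j _; rewrite mule_ge0 ?poweR_ge0// lee_fin powR_ge0.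
rewrite le_eqVlt; apply/orP; left; apply/eqP.
apply: eq_eseriesr => j _; rewrite /besov_density.
have s0 : 0 < t / 2 ^+ j by rewrite divr_gt0.
rewrite poweRM// ?lee_fin ?invr_ge0 ?powR_ge0// poweR_EFin.
have -> : (lam `^ q) ^+ j / 2 ^+ j =
    m * (mu ^+ j) `^ q / (((t / 2 ^+ j) `^ alpha)^-1 `^ q * (t / 2 ^+ j)^-1).
  rewrite /m powRM ?invr_ge0 ?(ltW t0) ?(ltW (p2_gt0 _))//.
  rewrite [(2 ^+ j)^-1 `^ _]powRV ?(ltW (p2_gt0 _))//.
  have -> : (2 ^+ j) `^ alpha = (2 `^ alpha) ^+ j :> R.
    by rewrite -powR_mulrn// powRAC powR_mulrn ?powR_ge0.
  have mj0 : 0 < mu ^+ j by rewrite exprn_gt0.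
  have aj0 : 0 < (2 `^ alpha) ^+ j :> R by rewrite exprn_gt0 ?powR_gt0.
  have -> : (lam `^ q) ^+ j = (mu ^+ j) `^ q / ((2 `^ alpha) ^+ j) `^ q.
    case/andP: lam01 => l0 _.
    rewrite -powR_mulrn ?powR_ge0// powRAC powR_mulrn ?(ltW l0)//.
    rewrite /lam expr_div_n powRM ?invr_ge0 ?(ltW mj0) ?(ltW aj0)//.
    by rewrite powRV ?(ltW aj0).
  rewrite !invfM !invrK.
  rewrite powRM ?invr_ge0 ?(ltW ta0) ?(ltW aj0)//.
  have D0 : 0 < (t `^ alpha)^-1 `^ q by rewrite powR_gt0 ?invr_gt0.
  have B0 : 0 < ((2 `^ alpha) ^+ j) `^ q :> R by exact: powR_gt0.
  field.
  by rewrite !gt_eqF ?p2_gt0.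
have e0 : 0 < ((t / 2 ^+ j) `^ alpha)^-1 `^ q * (t / 2 ^+ j)^-1.
  by rewrite mulr_gt0 ?invr_gt0 ?powR_gt0// invr_gt0 powR_gt0.
set e := _ * (t / _)^-1 in e0 *.
rewrite -[in RHS]muleA -EFinM -/e muleA -EFinM muleCA -EFinM.
by rewrite divfK ?gt_eqF// muleC.
Qed.

(** Integrated term by term, the series of [besov_density_le_series] becomes the
geometric series of ratio lam^q, since the dilated integrals are bounded by the
original one. *)
Lemma besov_norm_transfer_fin (q : R) : 0 < q ->
  (besov_norm T alpha p q%:E psi
     <= (C * (1 - lam `^ q)^-1 `^ q^-1)%:E * besov_norm T alpha p q%:E phi)%E.
Proof.
move=> q0; rewrite /besov_norm.
have lq : 0 < lam `^ q < 1.
  case/andP: lam01 => l0 l1; rewrite powR_gt0//=.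
  have := @gt0_ltr_powR R q q0 lam 1; rewrite !nnegrE powR1.
  by apply; rewrite ?ltW.
have lq1 : 0 < 1 - lam `^ q by case/andP: lq; rewrite subr_gt0.
set V := (\int[_]_(t in _) _)%E; set N := (\int[_]_(t in _) _)%E.
have F0 t : `]0, T]%classic t -> (0 <= besov_density T alpha p q phi t)%E.
  by rewrite /= in_itv /= => /andP[t0 _]; exact: besov_density_ge0.
have N0 : (0 <= N)%E by exact: integral_ge0.
have V0 : (0 <= V)%E.
  apply: integral_ge0 => t; rewrite /= in_itv /= => /andP[t0 _].
  exact: (@besov_density_ge0 _ _ _ _ _ psi).
suff VN : (V <= ((C `^ q) * (1 - lam `^ q)^-1)%:E * N)%E.
  have c0 : 0 <= (1 - lam `^ q)^-1 by rewrite invr_ge0 ltW.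
  apply: (@le_trans _ _ ((((C `^ q) * (1 - lam `^ q)^-1)%:E * N) `^ q^-1)%E).
    by rewrite lee_poweR2r ?invr_gt0// mule_ge0// lee_fin mulr_ge0 ?powR_ge0//.
  rewrite poweRM//; last by rewrite lee_fin mulr_ge0 ?powR_ge0.
  by rewrite poweR_EFin powRM ?powR_ge0// -powRrM mulfV ?gt_eqF// powRr1 ?(ltW C0).
have [->|Nfin] := eqVneq N +oo%E.
  by rewrite gt0_muley ?leey// lte_fin mulr_gt0 ?invr_gt0 ?powR_gt0.
have : N \is a fin_num by rewrite ge0_fin_numE// ltey.
move=> /fineK; set n := fine N => nN.
have n0 : 0 <= n by rewrite -lee_fin nN.
pose F j t := (((lam `^ q) ^+ j / 2 ^+ j)%:E *
                   besov_density T alpha p q phi (t / 2 ^+ j))%E.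
have e0 j : 0 <= (lam `^ q) ^+ j / 2 ^+ j.
  by rewrite divr_ge0 ?exprn_ge0 ?powR_ge0.
have Fj0 j t : `]0, T]%classic t -> (0 <= F j t)%E.
  rewrite /= in_itv /= => /andP[t0 _].
  by rewrite mule_ge0 ?lee_fin// besov_density_ge0 ?divr_gt0.
have mdj j : measurable_fun `]0, T]
    (fun t => besov_density T alpha p q phi (t / 2 ^+ j)).
  have comp := @measurable_comp _ _ _ R R (\bar R) `]0, T / 2 ^+ j]%classic
    (besov_density T alpha p q phi) `]0, T]%classic ( *%R^~ (2 ^+ j)^-1).
  apply: comp => //.
  - move=> _ [s /= + <-]; rewrite !in_itv /= => /andP[s0 sT].
    by rewrite divr_gt0//= ler_pM2r// invr_gt0.
  - exact: measurable_besov_density.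
  - exact: measurable_funM.
have mF j : measurable_fun `]0, T] (F j) by exact: emeasurable_funM.
apply: (@le_trans _ _ (\int[@lebesgue_measure R]_(t in `]0%R, T])
    ((C `^ q)%:E * \sum_(j <oo) F j t))%E).
  apply: ge0_le_integral_lower => t; rewrite /= in_itv /= => /andP[t0 _].
    exact: (@besov_density_ge0 _ _ _ _ _ psi).
  exact: besov_density_le_series.
rewrite ge0_integralZl_EFin ?powR_ge0//; last 2 first.
- by move=> t tT; apply: nneseries_ge0 => j _ _; exact: Fj0.
- apply: (@ge0_emeasurable_sum _ _ _ _ _ predT) => [j t tT _|j _].
    exact: Fj0.
  exact: mF.
rewrite EFinM -muleA lee_wpmul2l ?lee_fin ?powR_ge0//.
rewrite integral_nneseries// -nN -EFinM mulrC.
apply: le_trans (nneseries_geometric_le n0 lq).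
apply: lee_nneseries => j _; first by move=> _; apply: integral_ge0 => t; exact: Fj0.
have dj0 t : `]0, T]%classic t ->
    (0 <= besov_density T alpha p q phi (t / 2 ^+ j)%R)%E.
  by rewrite /= in_itv /= => /andP[t0 _]; rewrite besov_density_ge0 ?divr_gt0.
have -> : (\int[@lebesgue_measure R]_(t in `]0%R, T]) F j t =
    ((lam `^ q) ^+ j / 2 ^+ j)%:E * \int[@lebesgue_measure R]_(t in `]0%R, T])
      besov_density T alpha p q phi (t / 2 ^+ j)%R)%E.
  have mI : measurable `]0, T]%classic by [].
  exact: (ge0_integralZl_EFin (@lebesgue_measure R) mI dj0 (mdj j) (e0 j)).
have p1 : 1 <= 2 ^+ j :> R by rewrite exprn_ege1// ler1n.
have := integral_dilation_le p1 T0
  (@measurable_besov_density _ T alpha p q phi T)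
  (besov_density_ge0 T alpha p q phi).
rewrite -/N -nN -EFinM => /(lee_wpmul2l (_ : 0%E <= ((lam `^ q) ^+ j / 2 ^+ j)%:E)%E).
rewrite lee_fin => /(_ (e0 j)) /le_trans; apply; rewrite -EFinM lee_fin.
by rewrite mulrA divfK ?gt_eqF// mulrC.
Qed.

End besov_transfer.

Theorem theorem1p1 (R : realType) (alpha r : R) (p q : \bar R)
    (r_ge1 : 1 <= r) (alpha_gt0 : 0 < alpha)
    (p_gt0 : (0 < p)%E) (q_gt0 : (0 < q)%E)
    (alpha_r : alpha^-1 < r) (r_p : (r%:E <= p)%E) :
  exists c : R, 0 < c /\
    forall T : R, 0 < T ->
    forall (X : metricType R) (f : R -> X), {within `[0, T], continuous f} ->
      (besov_norm T alpha p q (fun s t : R => r_variation r f `[s, t])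
         <= c%:E * path_besov_norm T alpha p q f)%E.
Proof.
have r0 : 0 < r by exact: lt_le_trans r_ge1.
have r_alpha : r^-1 < alpha.
  by rewrite -[alpha]invrK ltf_pV2 ?posrE ?invr_gt0.
have two_gt1 x : 0 < x -> 1 < 2 `^ x :> R.
  move=> x0; have := @gt0_ltr_powR R x x0 1 2; rewrite !nnegrE powR1.
  by apply; rewrite // ltr1n.
have two_add x y : 2 `^ (x + y) = 2 `^ x * 2 `^ y :> R.
  by rewrite powRD// pnatr_eq0 implybT.
(* mu = 2^beta lies strictly between 2^(1/r) and 2^alpha, and eta is chosen so that
   kappa^3 is the ratio of 2^(1/r) to mu *)
pose beta := (alpha + r^-1) / 2.
pose eta := (beta - r^-1) / 3.
have eta0 : 0 < eta by rewrite /eta /beta; lra.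
pose mu : R := 2 `^ beta; pose kappa : R := 2 `^ (- eta).
pose nu : R := 2 `^ r^-1.
have mu0 : 0 < mu by exact: powR_gt0.
have k01 : 0 < kappa < 1.
  by rewrite powR_gt0//= /kappa powRN invf_lt1 ?two_gt1// powR_gt0.
have nuE : nu = kappa ^+ 3 * mu.
  rewrite /kappa -powR_mulrn ?powR_ge0// -powRrM -two_add; congr (_ `^ _).
  by rewrite /eta; lra.
have nur : nu `^ r = 2 by rewrite -powRrM mulVf ?gt_eqF// powRr1.
have mu_alpha : mu < 2 `^ alpha.
  have -> : alpha = beta + (alpha - beta) by lra.
  by rewrite two_add ltr_pMr// two_gt1// /beta; lra.
have k1 : 0 < 1 - kappa by case/andP: k01; rewrite subr_gt0.
pose C := 2 / (1 - kappa) ^+ 3.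
have C0 : 0 < C by rewrite divr_gt0 ?exprn_gt0.
have bound (T : R) (X : metricType R) (f : R -> X) :
    {within `[0, T], continuous f} -> forall t K, 0 < t -> 0 <= K ->
    (forall j, (omega T p (fun s t => (mdist (f s) (f t))%:E) (t / 2 ^+ j)
       <= (K / mu ^+ j)%:E)%E) ->
    (omega T p (fun s t => r_variation r f `[s, t]) t <= (C * K)%:E)%E.
  by move=> cf t K _ K0; exact: omega_variation_le k01 mu0 nuE nur _ _ _ _ _ cf K0.
case: q q_gt0 => [q| |] // q_gt0; last first.
  exists C; split=> // T T0 X f cf.
  exact: (besov_norm_transfer_infty C0 mu0 mu_alpha (bound T X f cf)).
rewrite lte_fin in q_gt0.
have lq : mu / 2 `^ alpha < 1 by rewrite ltr_pdivrMr ?powR_gt0// mul1r.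
exists (C * (1 - (mu / 2 `^ alpha) `^ q)^-1 `^ q^-1); split.
  have : (mu / 2 `^ alpha) `^ q < 1.
    have := @gt0_ltr_powR R q q_gt0 (mu / 2 `^ alpha) 1; rewrite !nnegrE powR1.
    by apply; rewrite // divr_ge0 ?powR_ge0.
  by move=> lq1; rewrite mulr_gt0// powR_gt0// invr_gt0 subr_gt0.
move=> T T0 X f cf.
exact: (besov_norm_transfer_fin T0 C0 mu0 mu_alpha (bound T X f cf)).
Qed.
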